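(* Let $P$ be a nonempty finite partially ordered set, $K$ a field, and $R$ the join-meet ring over $K$ arising from $P$, with canonical module $\omega_R$. Then $[\omega_R]=0$ in the divisor class group $\mathrm{Cl}(R)$ if and only if $P$ is pure.
   Context: $P$ is pure if every maximal chain of $P$ has the same cardinality. Let $P=\{x_1,\dots,x_n\}$ and $\hat P=P\cup\{\hat 0,\hat 1\}$, with the order of $P$ extended by $\hat 0<x_i<\hat 1$ for all $i$. $E(\hat P)$ is the set of edges of the Hasse diagram of $\hat P$: pairs $(x,y)\in\hat P\times\hat P$ with $x<y$ and no $z\in\hat P$ with $x<z<y$. To each $e\in E(\hat P)$ associate the linear form $f_e$ in the coordinates $x_0,x_1,\dots,x_n$ of $\mathbb{R}^{n+1}$: $f_e=x_i$ if $e=(x_i,\hat 1)$; $f_e=x_i-x_j$ if $e=(x_i,x_j)\in P\times P$; $f_e=x_0-x_j$ if $e=(\hat 0,x_j)$. Let $C\subset\mathbb{R}^{n+1}$ be the cone defined by $f_e\ge 0$ for all $e\in E(\hat P)$; its supporting hyperplanes are the $H_e=\{f_e=0\}$. The join-meet ring arising from $P$ is the affine semigroup ring $R=K[C\cap\mathbb{Z}^{n+1}]$; it is a normal Cohen--Macaulay domain. The canonical module $\omega_R$ is (identified with) the divisorial ideal of $R$ generated by the monomials whose exponent vectors lie in the relative interior of $C$, and $[\omega_R]$ is its class in $\mathrm{Cl}(R)$ (written additively). Equivalently, $[\omega_R]=\sum_{e\in E(\hat P)}[P_e]$, where $P_e\subset R$ is the height-one monomial prime ideal spanned over $K$ by all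 monomials with exponent vector in $(C\setminus H_e)\cap\mathbb{Z}^{n+1}$. *)

(* Defs.v *)
From HB Require Import structures.
From mathcomp Require Import all_boot all_order all_algebra generic_quotient.
From mathcomp Require Import finmap monalg.
From mathcomp Require Import ring lra zify.
From mathcomp Require Import boolp classical_sets reals.

Set Implicit Arguments.
Unset Strict Implicit.
Unset Printing Implicit Defensive.

Import Order.TTheory GRing.Theory Num.Theory.
Local Open Scope classical_set_scope.
Local Open Scope ring_scope.
Local Open Scope quotient_scope.

(* [colon S] is (R : S) in the field of fractions.  Cl(R) is the monoid of
   nonzero divisorial fractional ideals of R under I . J = (R : (R : IJ)),
   written additively, modulo the nonzero principal fractional ideals.  It
   is defined as a commutative monoid for every domain; by [clgroup_inv] it is
   a group when R is completely integrally closed, in particular when R is a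
   normal Noetherian domain. *)

Section DivisorClasses.
Variable R : idomainType.
Local Notation F := {fraction R}.
Local Notation "a %:F" := (@tofrac R a).
Implicit Types (S T : set F) (f x y : F).

Definition integral_elts : set F := range (@tofrac R).

Definition colon S : set F :=
  [set x | forall y, S y -> integral_elts (x * y)].

Definition is_fractional_ideal (I : set F) : Prop :=
  [/\ I 0, forall x y, I x -> I y -> I (x + y),
      forall (a : R) x, I x -> I (a%:F * x),
      exists2 x, I x & x != 0
    & exists2 d : R, d != 0 & forall x, I x -> integral_elts (d%:F * x)].

Definition is_divisorial (I : set F) : Prop :=
  is_fractional_ideal I /\ colon (colon I) = I.

Record divisorial_ideal := DivisorialIdeal {
  divisorial_set :> set F;
  divisorialP : is_divisorial divisorial_set }.

HB.instance Definition _ := gen_eqMixin divisorial_ideal.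
HB.instance Definition _ := gen_choiceMixin divisorial_ideal.

Lemma divisorial_inj (A B : divisorial_ideal) :
  divisorial_set A = divisorial_set B -> A = B.
Proof.
case: A B => [A pA] [B pB] /= eAB; move: pB; rewrite -eAB => pB.
by congr DivisorialIdeal; apply: Prop_irrelevance.
Qed.

Definition dilate f S : set F := [set f * x | x in S].

Definition prod_set S T : set F := [set x * y | x in S & y in T].

Lemma int0 : integral_elts 0. Proof. by exists 0; rewrite ?tofrac0. Qed.
Lemma int1 : integral_elts 1. Proof. by exists 1; rewrite ?tofrac1. Qed.
Lemma intF a : integral_elts a%:F. Proof. by exists a. Qed.
Lemma intD x y : integral_elts x -> integral_elts y -> integral_elts (x + y).
Proof. by move=> [a _ <-] [b _ <-]; exists (a + b); rewrite ?tofracD. Qed.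
Lemma intM x y : integral_elts x -> integral_elts y -> integral_elts (x * y).
Proof. by move=> [a _ <-] [b _ <-]; exists (a * b); rewrite ?tofracM. Qed.

Lemma colon_sub S T : S `<=` T -> colon T `<=` colon S.
Proof. by move=> sST x Tx y /sST; exact: Tx. Qed.

Lemma sub_colon2 S : S `<=` colon (colon S).
Proof. by move=> x Sx y Sy; rewrite mulrC; exact: Sy. Qed.

Lemma colon3 S : colon (colon (colon S)) = colon S.
Proof.
apply/seteqP; split; last exact: sub_colon2.
exact/colon_sub/sub_colon2.
Qed.

Lemma colonP S T : colon (prod_set S T) =
  [set x | forall s t, S s -> T t -> integral_elts (x * (s * t))].
Proof.
apply/seteqP; split=> x /= xP.
  by move=> s t Ss Tt; apply: xP; exists s => //; exists t.
by move=> _ [s Ss [t Tt <-]]; exact: xP.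
Qed.

Lemma prod_setC S T : prod_set S T = prod_set T S.
Proof.
by apply/seteqP; split=> _ [s Ss [t Tt <-]]; exists t => //; exists s;
  rewrite // mulrC.
Qed.

Lemma colon_prod2 S T :
  colon (prod_set (colon (colon S)) T) = colon (prod_set S T).
Proof.
rewrite !colonP; apply/seteqP; split=> x /= xP s t Ss Tt.
  by apply: xP => //; exact: sub_colon2.
rewrite mulrCA; apply: Ss => s' Ss'.
by rewrite -mulrA [t * s']mulrC; exact: xP.
Qed.

Lemma colon_dilate f S : f != 0 -> colon (dilate f S) = dilate f^-1 (colon S).
Proof.
move=> f0; apply/seteqP; split=> x /=.
  move=> xP; exists (f * x); last by rewrite mulKf.
  by move=> y Sy; rewrite mulrAC mulrC mulrCA mulrC mulrAC -mulrA; apply: xP;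
     exists y.
move=> [y yP <-] _ [z Sz <-].
by rewrite mulrACA mulVf // mul1r; exact: yP.
Qed.

Lemma dilate1 S : dilate 1 S = S.
Proof.
apply/seteqP; split=> [_ [x Sx <-]|x Sx]; first by rewrite mul1r.
by exists x; rewrite // mul1r.
Qed.

Lemma dilateM f g S : dilate f (dilate g S) = dilate (f * g) S.
Proof.
apply/seteqP; split=> [_ [_ [x Sx <-] <-]|_ [x Sx <-]].
  by exists x; rewrite // mulrA.
by exists (g * x); [exists x | rewrite mulrA].
Qed.

Lemma prod_dilate f S T : prod_set (dilate f S) T = dilate f (prod_set S T).
Proof.
apply/seteqP; split=> [_ [_ [x Sx <-] [y Ty <-]]|_ [_ [x Sx [y Ty <-]] <-]].
  by exists (x * y); [exists x => //; exists y | rewrite mulrA].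
by exists (f * x); [exists x | exists y; rewrite // mulrA].
Qed.

Lemma colon_submod S :
  [/\ colon S 0, forall x y, colon S x -> colon S y -> colon S (x + y)
    & forall (a : R) x, colon S x -> colon S (a%:F * x)].
Proof.
split=> [y _|x y Sx Sy z Sz|a x Sx z Sz]; first by rewrite mul0r; exact: int0.
  by rewrite mulrDl; apply: intD; [exact: Sx | exact: Sy].
by rewrite -mulrA; apply: intM; [exact: intF | exact: Sx].
Qed.

Lemma fracP x : exists (a b : R), b != 0 /\ x * b%:F = a%:F.
Proof.
elim/quotW: x => r; exists r.1, r.2; split; first exact: denom_ratioP.
change (FracField.mul (\pi r) (tofrac r.2) = tofrac r.1).
rewrite !piE; apply/eqmodP; rewrite /= FracField.equivfE /FracField.mulf.
by rewrite !numden_Ratio ?mulf_neq0 ?oner_neq0 ?denom_ratioP // !mulr1 mulrC.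
Qed.

Definition has_int S := exists2 a : R, a != 0 & S a%:F.

Lemma divisorial_colon S :
  has_int S -> has_int (colon S) -> is_divisorial (colon S).
Proof.
move=> [a a0 Sa] [b b0 Sb]; split; last exact: colon3.
have [c0 cD cM] := colon_submod S; split=> //.
  by exists b%:F; rewrite ?tofrac_eq0.
by exists a => // x; rewrite mulrC; apply.
Qed.

Lemma has_int_fractional (I : set F) : is_fractional_ideal I ->
  has_int I /\ has_int (colon I).
Proof.
move=> [I0 ID IM [x Ix x0] [d d0 dP]]; split; last by exists d.
have [a [b [b0 xb]]] := fracP x; exists a; last first.
  by rewrite -xb mulrC; exact: IM.
by rewrite -tofrac_eq0 -xb mulf_neq0 ?tofrac_eq0.
Qed.

Implicit Types I J L : divisorial_ideal.

Lemma has_int_div (I : divisorial_ideal) : has_int I /\ has_int (colon I).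
Proof. by apply: has_int_fractional; case: (divisorialP I). Qed.

Lemma colon_int : colon integral_elts = integral_elts.
Proof.
apply/seteqP; split=> x xP.
  by rewrite -[x]mulr1; apply: xP; exact: int1.
by move=> y; exact: intM.
Qed.

Lemma unit_ideal_divisorial : is_divisorial integral_elts.
Proof.
rewrite -colon_int; apply: divisorial_colon; rewrite ?colon_int;
  by exists 1; rewrite ?oner_neq0 // tofrac1; exact: int1.
Qed.

Definition unit_ideal := DivisorialIdeal unit_ideal_divisorial.

Lemma mul_ideal_divisorial (I J : divisorial_ideal) :
  is_divisorial (colon (colon (prod_set I J))).
Proof.
have [[a a0 Ia] [b b0 Ib]] := has_int_div I.
have [[c c0 Jc] [d d0 Jd]] := has_int_div J.
apply: divisorial_colon.
  exists (b * d); first by rewrite mulf_neq0.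
  move=> _ [x Ix [y Jy <-]].
  by rewrite tofracM mulrACA; apply: intM; [exact: Ib | exact: Jd].
exists (a * c); first by rewrite mulf_neq0.
by apply: sub_colon2; exists a%:F => //; exists c%:F => //; rewrite tofracM.
Qed.

Definition mul_ideal (I J : divisorial_ideal) := DivisorialIdeal (mul_ideal_divisorial I J).

Lemma mul_idealC I J : mul_ideal I J = mul_ideal J I.
Proof. by apply: divisorial_inj; rewrite /= prod_setC. Qed.

Lemma prod_setA S T U :
  prod_set S (prod_set T U) = prod_set (prod_set S T) U.
Proof.
apply/seteqP; split.
  move=> _ [s Ss [_ [t Tt [u Uu <-]] <-]].
  by exists (s * t); [exists s => //; exists t | exists u; rewrite // mulrA].
move=> _ [_ [s Ss [t Tt <-]] [u Uu <-]].
exists s => //; exists (t * u); last by rewrite mulrA.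
by exists t => //; exists u.
Qed.

Lemma mul_idealA I J L :
  mul_ideal I (mul_ideal J L) = mul_ideal (mul_ideal I J) L.
Proof.
apply: divisorial_inj => /=.
by rewrite prod_setC !colon_prod2 prod_setC prod_setA.
Qed.

Lemma mul_ideal1 I : mul_ideal unit_ideal I = I.
Proof.
apply: divisorial_inj => /=; case: I => I [[I0 ID IM _ _] cI] /=.
suff -> : prod_set integral_elts I = I by [].
apply/seteqP; split=> [_ [_ [a _ <-] [x Ix <-]]|x Ix]; first exact: IM.
by exists 1; [exact: int1 | exists x; rewrite // mul1r].
Qed.

Definition lin_equiv : rel divisorial_ideal := fun I J =>
  `[< exists2 f, f != 0 & J = dilate f I :> set F >].

Lemma lin_equiv_refl : reflexive lin_equiv.
Proof. by move=> I; apply/asboolP; exists 1; rewrite ?oner_neq0 ?dilate1. Qed.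

Lemma lin_equiv_sym : symmetric lin_equiv.
Proof.
suff H I J : lin_equiv I J -> lin_equiv J I by move=> I J; apply/idP/idP; exact: H.
move=> /asboolP[f f0 eJ]; apply/asboolP; exists f^-1; first by rewrite invr_eq0.
by rewrite eJ dilateM mulVf // dilate1.
Qed.

Lemma lin_equiv_trans : transitive lin_equiv.
Proof.
move=> J I L /asboolP[f f0 eJ] /asboolP[g g0 eL]; apply/asboolP.
by exists (g * f); rewrite ?mulf_neq0 // eL eJ dilateM.
Qed.

Canonical lin_equiv_equiv :=
  EquivRel lin_equiv lin_equiv_refl lin_equiv_sym lin_equiv_trans.

Definition clgroup := {eq_quot lin_equiv}.
HB.instance Definition _ : EqQuotient _ lin_equiv clgroup :=
  EqQuotient.on clgroup.
HB.instance Definition _ := Choice.on clgroup.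

Definition idclass (I : divisorial_ideal) : clgroup := \pi_clgroup I.

Definition cladd := lift_op2 clgroup mul_ideal.

Lemma lin_equiv_mull (I J L : divisorial_ideal) :
  lin_equiv I J -> lin_equiv (mul_ideal I L) (mul_ideal J L).
Proof.
move=> /asboolP[f f0 eJ]; apply/asboolP; exists f => //=.
by rewrite eJ prod_dilate !colon_dilate ?invr_eq0 // invrK.
Qed.

Lemma pi_cladd : {morph \pi_clgroup : I J / mul_ideal I J >-> cladd I J}.
Proof.
move=> I J; unlock cladd; apply/eqmodP => /=.
have rP (L : divisorial_ideal) : lin_equiv L (repr (\pi_clgroup L)).
  by apply/eqmodP; rewrite reprK.
apply: (@lin_equiv_trans (mul_ideal (repr (\pi_clgroup I)) J)).
  exact/lin_equiv_mull/rP.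
by rewrite mul_idealC [X in lin_equiv _ X]mul_idealC; exact/lin_equiv_mull/rP.
Qed.
Canonical pi_cladd_morph := PiMorph2 pi_cladd.

Lemma cladd_assoc : associative cladd.
Proof.
elim/quotW=> I; elim/quotW=> J; elim/quotW=> L.
by rewrite !piE mul_idealA.
Qed.

Lemma cladd_comm : commutative cladd.
Proof. by elim/quotW=> I; elim/quotW=> J; rewrite !piE mul_idealC. Qed.

Lemma cladd0 : left_id (idclass unit_ideal) cladd.
Proof. by elim/quotW=> I; rewrite /idclass !piE mul_ideal1. Qed.

HB.instance Definition _ :=
  GRing.isNmodule.Build clgroup cladd_assoc cladd_comm cladd0.

Lemma idclass_eq0 (I : divisorial_ideal) :
  idclass I = 0 <-> exists2 f, f != 0 & I = dilate f integral_elts :> set F.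
Proof.
split=> [/esym /eqmodP /asboolP //|]; last first.
  by move=> h; apply/esym/eqmodP/asboolP.
Qed.

Definition completely_integrally_closed : Prop := forall x,
  (exists2 d : R, d != 0 & forall n, integral_elts (d%:F * x ^+ n)) ->
  integral_elts x.

Lemma clgroup_inv : completely_integrally_closed ->
  forall c : clgroup, exists c', c + c' = 0.
Proof.
move=> cic; elim/quotW => I.
have [nI nJ] := has_int_div I.
have eI : colon (colon I) = I by case: (divisorialP I).
have dJ : is_divisorial (colon I) by exact: divisorial_colon.
exists (idclass (DivisorialIdeal dJ)).
rewrite [LHS](_ : _ = cladd (\pi_clgroup I) (idclass (DivisorialIdeal dJ))) //.
rewrite /idclass !piE -[RHS]/(idclass unit_ideal) /idclass.
congr (\pi _); apply: divisorial_inj => /=; rewrite -colon_int; congr colon.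
apply/seteqP; rewrite colonP; split=> x xP; last first.
  by move=> s t Is Jt; apply: intM => //; rewrite mulrC; exact: Jt.
have xJ n y : colon I y -> colon I (x ^+ n * y).
  elim: n => [|n IHn] Iy; first by rewrite mul1r.
  move=> s Is; have -> : x ^+ n.+1 * y * s = x * (s * (x ^+ n * y)).
    by rewrite exprS [s * _]mulrC !mulrA.
  by apply: xP => //; exact: IHn.
case: nI => a a0 Ia; case: nJ => b b0 Jb.
apply: cic; exists (b * a); first by rewrite mulf_neq0.
by move=> n; rewrite tofracM mulrC mulrA; exact: xJ.
Qed.

End DivisorClasses.

Definition ideal_span (R : comNzRingType) (S : set R) : set R :=
  [set x | exists s : seq (R * R),
     (forall p, p \in s -> S p.2) /\ x = \sum_(p <- s) p.1 * p.2].

Section RelativeInterior.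
Variables (Rl : realType) (I : finType).
Local Notation V := {ffun I -> Rl}.

Definition affine_hull (A : set V) : set V :=
  [set x | exists s : seq (Rl * V),
     [/\ forall p, p \in s -> A p.2, \sum_(p <- s) p.1 = 1
       & forall i, x i = \sum_(p <- s) p.1 * p.2 i]].

Definition relative_interior (A : set V) : set V :=
  [set x | A x /\ exists2 eps : Rl, 0 < eps &
     forall y, affine_hull A y -> (forall i, `|x i - y i| < eps) -> A y].

End RelativeInterior.

Definition is_chain d (P : finPOrderType d) (A : {set P}) : bool :=
  [forall x in A, forall y in A, (x >=< y)%O].

Definition pure d (P : finPOrderType d) : Prop :=
  forall A B : {set P},
    maxset (@is_chain d P) A -> maxset (@is_chain d P) B -> #|A| = #|B|.

Inductive hat (T : Type) := Bot | Elt of T | Top.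
Arguments Bot {T}.
Arguments Top {T}.

Definition hat_code T (x : hat T) : option (option T) :=
  match x with Bot => None | Top => Some None | Elt t => Some (Some t) end.
Definition hat_decode T (c : option (option T)) : hat T :=
  match c with None => Bot | Some None => Top | Some (Some t) => Elt t end.
Lemma hat_codeK T : cancel (@hat_code T) (@hat_decode T).
Proof. by case. Qed.

HB.instance Definition _ (T : eqType) :=
  Equality.copy (hat T) (can_type (@hat_codeK T)).
HB.instance Definition _ (T : choiceType) :=
  Choice.copy (hat T) (can_type (@hat_codeK T)).
HB.instance Definition _ (T : countType) :=
  Countable.copy (hat T) (can_type (@hat_codeK T)).
HB.instance Definition _ (T : finType) :=
  Finite.copy (hat T) (can_type (@hat_codeK T)).

Section HatOrder.
Variables (d : Order.disp_t) (P : porderType d).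

Definition hat_le (x y : hat P) : bool :=
  match x, y with
  | Bot, _ => true
  | _, Top => true
  | Elt a, Elt b => (a <= b)%O
  | _, _ => false
  end.

Lemma hat_le_refl : reflexive hat_le.
Proof. by case=> //= x; exact: lexx. Qed.
Lemma hat_le_anti : antisymmetric hat_le.
Proof. by case=> [|x|] [|y|] //= /le_anti ->. Qed.
Lemma hat_le_trans : transitive hat_le.
Proof. by case=> [|x|] [|y|] [|z|] //=; exact: le_trans. Qed.

HB.instance Definition _ := Order.Le_isPOrder.Build d (hat P)
  hat_le_refl hat_le_anti hat_le_trans.
End HatOrder.

HB.instance Definition _ d (P : finPOrderType d) := Finite.on (hat P).

Definition hasse_edges d (Q : finPOrderType d) : {set Q * Q} :=
  [set e | (e.1 < e.2)%O && ~~ [exists z, (e.1 < z < e.2)%O]].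

(* The coordinates x_0, x_1, ..., x_n are indexed by [option P]: [None] is the
   index 0 and [Some x] the index of x. *)

Section EdgeForm.
Variables (d : Order.disp_t) (P : finPOrderType d) (V : zmodType).

Definition hat_coord (v : {ffun option P -> V}) (x : hat P) : V :=
  match x with Bot => v None | Elt a => v (Some a) | Top => 0 end.

(* As the value at the top is 0, this is x_i on (x_i, Top), x_i - x_j on
   (x_i, x_j) and x_0 - x_j on (Bot, x_j). *)
Definition edge_form (e : hat P * hat P) (v : {ffun option P -> V}) : V :=
  hat_coord v e.1 - hat_coord v e.2.
End EdgeForm.

Section Cone.
Variables (Rl : realType) (d : Order.disp_t) (P : finPOrderType d).

Definition cone : pred {ffun option P -> Rl} :=
  fun v => [forall e in hasse_edges (hat P), 0 <= edge_form e v].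

Definition real_point (v : {ffun option P -> int}) : {ffun option P -> Rl} :=
  [ffun i => (v i)%:~R].

Record cone_point := ConePoint {
  exponent :> {ffun option P -> int};
  cone_pointP : cone (real_point exponent) }.

HB.instance Definition _ := [isSub for exponent].
HB.instance Definition _ := [Choice of cone_point by <:].

Definition interior_point (m : cone_point) : Prop :=
  relative_interior [set v | cone v] (real_point m).

End Cone.

Lemma exists_cover d (Q : finPOrderType d) (x y : Q) : (x < y)%O ->
  exists2 z, (x, z) \in hasse_edges Q & (z <= y)%O.
Proof.
move=> xy.
have Py : (x < y <= y)%O by rewrite xy lexx.
case: (@arg_minnP _ y (fun z => x < z <= y)%O
         (fun z => #|[pred t | t <= z]%O|) Py) => z /andP[xz zy] zmin.
exists z => //; rewrite inE /= xz; apply/existsPn => t; apply/negP => /andP[xt tz].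
have /zmin : (x < t <= y)%O by rewrite xt (le_trans (ltW tz)).
apply/negP; rewrite -ltnNge; apply: proper_card; apply/properP; split.
  by apply/fintype.subsetP => s; rewrite !inE => /le_trans; apply; exact: ltW.
by exists z; rewrite !inE ?lexx // lt_geF.
Qed.

Lemma hasse_ind d (Q : finPOrderType d) (r : rel Q) :
  reflexive r -> transitive r ->
  (forall x y, (x, y) \in hasse_edges Q -> r x y) ->
  forall x y, (x <= y)%O -> r x y.
Proof.
move=> r1 rT rE x y; have [n] := ubnP #|[pred t | x < t]%O|.
elim: n x => // n IHn x; rewrite ltnS => xn; rewrite le_eqVlt.
case/predU1P => [->//|/exists_cover[z xz zy]].
apply: (rT z); first exact: rE.
apply: IHn zy; apply: leq_trans xn; apply: proper_card.
move: xz; rewrite inE /= => /andP[xz _]; apply/properP; split.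
  by apply/fintype.subsetP => s; rewrite !inE; exact: lt_trans.
by exists z; rewrite !inE ?ltxx.
Qed.

Section ConeFacts.
Variables (Rl : realType) (d : Order.disp_t) (P : finPOrderType d).
Local Notation hasseP := (hasse_edges (hat P)).
Implicit Types v w : {ffun option P -> int}.

Lemma edge_formE v e : edge_form e (real_point Rl v) = (edge_form e v)%:~R.
Proof.
by rewrite /edge_form; case: e => [[|a|] [|b|]] /=; rewrite ?ffunE intrB.
Qed.

Lemma coneP v :
  reflect (forall e, e \in hasseP -> 0 <= edge_form e v)
          (cone (real_point Rl v)).
Proof.
by apply: (iffP forall_inP) => h e /h; rewrite edge_formE ler0z.
Qed.

Lemma hat_coordD (V : zmodType) (v w : {ffun option P -> V}) x :
  hat_coord (v + w) x = hat_coord v x + hat_coord w x.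
Proof. by case: x => [|a|] /=; rewrite ?ffunE ?addr0. Qed.

Lemma edge_formD (V : zmodType) e (v w : {ffun option P -> V}) :
  edge_form e (v + w) = edge_form e v + edge_form e w.
Proof. by rewrite /edge_form !hat_coordD opprD addrACA. Qed.

Lemma edge_form0 (V : zmodType) e : edge_form e (0 : {ffun option P -> V}) = 0.
Proof. by apply: (addrI (edge_form e 0)); rewrite -edge_formD !addr0. Qed.

Lemma edge_formN (V : zmodType) e (v : {ffun option P -> V}) :
  edge_form e (- v) = - edge_form e v.
Proof. by apply/eqP; rewrite -addr_eq0 -edge_formD addNr edge_form0. Qed.

Lemma cone_ge0 v : cone (real_point Rl v) -> forall i, 0 <= v i.
Proof.
move=> /coneP vP.
have mon x y : (x <= y)%O -> hat_coord v y <= hat_coord v x.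
  apply: (@hasse_ind _ (hat P) (fun x y => hat_coord v y <= hat_coord v x)).
  - by move=> z; exact: lexx.
  - by move=> z t s ht hs; exact: le_trans hs ht.
  - by move=> z t /vP; rewrite subr_ge0.
case=> [a|]; first exact: (mon (Elt a) Top).
exact: (mon Bot Top).
Qed.

Lemma cone_0 : cone (real_point Rl (0 : {ffun option P -> int})).
Proof. by apply/coneP => e _; rewrite edge_form0. Qed.

Lemma cone_D v w : cone (real_point Rl v) -> cone (real_point Rl w) ->
  cone (real_point Rl (v + w)).
Proof.
move=> /coneP vP /coneP wP; apply/coneP => e eE.
by rewrite edge_formD addr_ge0 ?vP ?wP.
Qed.

Definition cp_one := ConePoint cone_0.
Definition cp_mul (a b : cone_point Rl P) :=
  ConePoint (cone_D (cone_pointP a) (cone_pointP b)).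

Lemma cp_mulA : associative cp_mul.
Proof. by move=> a b c; apply: val_inj; rewrite /= addrA. Qed.
Lemma cp_mulC : commutative cp_mul.
Proof. by move=> a b; apply: val_inj; rewrite /= addrC. Qed.
Lemma cp_mul1 : left_id cp_one cp_mul.
Proof. by move=> a; apply: val_inj; rewrite /= add0r. Qed.
Lemma cp_mulr1 : right_id cp_one cp_mul.
Proof. by move=> a; rewrite cp_mulC cp_mul1. Qed.
Lemma cp_unit a b : cp_mul a b = cp_one -> a = cp_one /\ b = cp_one.
Proof.
move=> /(congr1 val) /= /ffunP ab0.
have a0 := cone_ge0 (cone_pointP a); have b0 := cone_ge0 (cone_pointP b).
split; apply: val_inj; apply/ffunP => i /=;
  have := ab0 i; have := a0 i; have := b0 i; rewrite !ffunE => ? ?;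
  by move/eqP; rewrite paddr_eq0 // => /andP[/eqP ? /eqP ?].
Qed.

HB.instance Definition _ := Choice_isMonomialDef.Build (cone_point Rl P)
  cp_mulA cp_mul1 cp_mulr1 cp_unit.
HB.instance Definition _ :=
  MonomialDef_isConomialDef.Build (cone_point Rl P) cp_mulC.

End ConeFacts.

Definition join_meet_ring (Rl : realType) (K : fieldType) d
  (P : finPOrderType d) := {malg K[cone_point Rl P]}.

Section Domain.
Variables (Rl : realType) (K : fieldType).
Variables (d : Order.disp_t) (P : finPOrderType d).
Local Notation M := (cone_point Rl P).
Local Notation R := (join_meet_ring Rl K P).

HB.instance Definition _ := GRing.ComNzRing.on R.

Fixpoint lexpos (s : seq (option P)) (v : option P -> int) : bool :=
  if s is i :: s' then (0 < v i) || (v i == 0) && lexpos s' v else false.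

Lemma lexposD s (v w : {ffun option P -> int}) :
  lexpos s v -> lexpos s w -> lexpos s (v + w).
Proof.
elim: s => //= i s IHs; rewrite !ffunE.
case/orP=> [v0|/andP[/eqP v0 vs]]; case/orP=> [w0|/andP[/eqP w0 ws]].
- by rewrite addr_gt0.
- by rewrite w0 addr0 v0.
- by rewrite v0 add0r w0.
- by rewrite v0 w0 addr0 eqxx IHs ?orbT.
Qed.

Lemma lexpos0 s : lexpos s (0 : {ffun option P -> int}) = false.
Proof. by elim: s => //= i s ->; rewrite ffunE ltxx andbF. Qed.

Lemma lexpos_total s (v : {ffun option P -> int}) :
  (exists2 i, i \in s & v i != 0) -> lexpos s v || lexpos s (- v).
Proof.
elim: s => [[]//|i s IHs] /= [j]; rewrite inE !ffunE oppr_gt0 oppr_eq0.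
have [v0|v0|v0] //= := ltgtP (v i) 0; rewrite ?orbT //.
case/predU1P=> [->|js vj]; first by rewrite v0 eqxx.
by apply: IHs; exists j.
Qed.

Definition cp_gt (a b : M) := lexpos (enum {: option P}) (val a - val b).

Lemma cp_gt_total (a b : M) : a != b -> cp_gt a b || cp_gt b a.
Proof.
move=> ab; rewrite /cp_gt -[val b - val a]opprB; apply: lexpos_total.
apply: contrapT => h; case/eqP: ab; apply/val_inj/eqP; rewrite -subr_eq0.
apply/eqP/ffunP => i; rewrite [RHS]ffunE; apply/eqP/negPn/negP => hi.
by apply: h; exists i; rewrite ?mem_enum.
Qed.

Lemma cp_gt_trans (a b c : M) : cp_gt a b -> cp_gt b c -> cp_gt a c.
Proof.
rewrite /cp_gt => ab bc.
have -> : val a - val c = (val a - val b) + (val b - val c).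
  by rewrite addrA subrK.
exact: lexposD.
Qed.

Lemma cp_gt_max (s : seq M) : s != [::] ->
  exists2 a, a \in s & forall b, b \in s -> b != a -> cp_gt a b.
Proof.
elim: s => // a s IHs _; have [->|/IHs[m ms mP]] := eqVneq s [::].
  by exists a; rewrite ?mem_head // => b; rewrite inE => ->.
have [am|am] := eqVneq a m.
  exists m; first by rewrite inE ms orbT.
  by move=> b; rewrite inE am => /predU1P[->|/mP//]; rewrite eqxx.
case/orP: (cp_gt_total am) => [a_m|m_a].
  exists a; first exact: mem_head.
  move=> b; rewrite inE => /predU1P[->|bs ba]; first by rewrite eqxx.
  by have [->//|/(mP _ bs)] := eqVneq b m; exact: cp_gt_trans.
exists m; first by rewrite inE ms orbT.
by move=> b; rewrite inE => /predU1P[->//|/mP].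
Qed.

Lemma msupp_max (f : R) : f != 0 -> exists2 a, a \in msupp f &
  forall b, b \in msupp f -> b != a -> cp_gt a b.
Proof.
move=> f0; have : enum_fset (msupp f) != [::].
  apply: contraNneq f0 => f0; rewrite -msupp_eq0; apply/eqP/fsetP => x.
  by rewrite in_fset0 -[LHS]/(x \in enum_fset (msupp f)) f0.
by move=> /cp_gt_max.
Qed.

Lemma cp_max_uniq (a b x y : M) : (x = a \/ cp_gt a x) -> (y = b \/ cp_gt b y) ->
  mmul x y = mmul a b -> x = a /\ y = b.
Proof.
rewrite /cp_gt => xa yb /(congr1 val) /= exy.
have e0 : (val a - val x) + (val b - val y) = 0.
  by rewrite addrACA -opprD [X in _ - X]exy subrr.
case: xa yb => [xa|xa] [yb|yb] //; exfalso.
- by move: yb; rewrite xa subrr add0r in e0; rewrite e0 lexpos0.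
- by move: xa; rewrite yb subrr addr0 in e0; rewrite e0 lexpos0.
- by have := lexposD xa yb; rewrite e0 lexpos0.
Qed.

Lemma jm_mulf_eq0 (f g : R) : f * g = 0 -> (f == 0) || (g == 0).
Proof.
apply: contra_eqT; rewrite negb_or => /andP[/msupp_max[a af aP] /msupp_max[b bg bP]].
have aP' x : x \in msupp f -> x = a \/ cp_gt a x.
  by move=> xf; have [|/(aP _ xf)] := eqVneq x a; [left | right].
have bP' x : x \in msupp g -> x = b \/ cp_gt b x.
  by move=> xg; have [|/(bP _ xg)] := eqVneq x b; [left | right].
apply/eqP => /(congr1 (mcoeff (mmul a b))); rewrite mcoeff0 mcoeffMl.
rewrite (big_fsetD1 a) //= (big_fsetD1 b) //= eqxx mulr1n.
rewrite !big1_fset ?addr0.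
- by move/eqP; rewrite mulf_eq0 !mcoeff_eq0 af bg.
- move=> x; rewrite in_fsetD1 => /andP[/eqP xa xf] _.
  rewrite big1_fset // => y yg _; case: eqP => // e.
  by case: (cp_max_uniq (aP' _ xf) (bP' _ yg) e).
- move=> y; rewrite in_fsetD1 => /andP[/eqP yb yg] _; case: eqP => // e.
  by case: (cp_max_uniq (or_introl erefl) (bP' _ yg) e).
Qed.

Definition jm_unit : pred R := fun f => `[< exists g, g * f = 1 >].

Definition jm_inv (f : R) : R :=
  if pselect (exists g, g * f = 1) is left h then projT1 (cid h) else f.

Lemma jm_mulVf : {in jm_unit, left_inverse 1 jm_inv *%R}.
Proof.
move=> f /asboolP uf; rewrite /jm_inv; case: pselect => // h.
by case: (cid h).
Qed.

Lemma jm_unitP (f g : R) : g * f = 1 -> jm_unit f.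
Proof. by move=> gf; apply/asboolP; exists g. Qed.

Lemma jm_inv_out : {in [predC jm_unit], jm_inv =1 id}.
Proof.
by move=> f /asboolPn uf; rewrite /jm_inv; case: pselect.
Qed.

HB.instance Definition _ := GRing.ComNzRing_hasMulInverse.Build R
  jm_mulVf jm_unitP jm_inv_out.
HB.instance Definition _ := GRing.ComUnitRing_isIntegral.Build R jm_mulf_eq0.

End Domain.

Section CanonicalIdeal.
Variables (Rl : realType) (K : fieldType).
Variables (d : Order.disp_t) (P : finPOrderType d).
Local Notation M := (cone_point Rl P).
Local Notation R := (join_meet_ring Rl K P).
Local Notation hasseP := (hasse_edges (hat P)).

Definition monomial (m : M) : R := << m >>.

Definition canonical_ideal : set R :=
  ideal_span [set monomial m | m in [set m | interior_point m]].

Definition canonical_set : set {fraction R} :=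
  [set tofrac g | g in canonical_ideal].

Definition rank_point : {ffun option P -> int} :=
  [ffun i => if i is Some a then #|[pred b | a <= b]%O|%:Z else #|P|.+1%:Z].

Lemma rank_pointP e : e \in hasseP -> 1 <= edge_form e rank_point.
Proof.
case: e => x y; rewrite inE /= => /andP[xy _]; rewrite lerBrDr.
move: x y xy => [|a|] [|b|] //=; rewrite ?ffunE.
- by move=> _; rewrite lez_nat add1n ltnS max_card.
- by [].
- rewrite lt_def => /andP[ba ab]; have {ba ab}ab : (a < b)%O by rewrite lt_def ba.
  rewrite lez_nat add1n; apply: proper_card; apply/properP; split.
    by apply/fintype.subsetP => t; rewrite !inE; exact: (le_trans (ltW ab)).
  by exists a; rewrite !inE ?lexx // lt_geF.
- by move=> _; rewrite lez_nat addn0; apply/card_gt0P; exists a; rewrite inE lexx.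
Qed.

Lemma cone_strict_nbhs (x : {ffun option P -> Rl}) :
  (forall e, e \in hasseP -> 0 < edge_form e x) ->
  exists2 eps : Rl, 0 < eps &
    forall y : {ffun option P -> Rl}, (forall i, `|x i - y i| < eps) -> cone y.
Proof.
move=> xP; have [eps eps0 epsP] : exists2 eps : Rl, 0 < eps &
    forall e, e \in hasseP -> eps + eps <= edge_form e x.
  exists ((\big[Num.min/1]_(e in hasseP) edge_form e x) / 2).
    by rewrite divr_gt0 //; elim/big_ind: _ => // a b a0 b0; rewrite lt_min a0.
  by move=> e eE; rewrite -splitr; exact: bigmin_le_cond.
exists eps => // y xy; apply/forall_inP => e /epsP.
have xyh z : `|hat_coord x z - hat_coord y z| < eps.
  by case: z => [|a|] /=; rewrite ?xy // subrr normr0.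
have := xyh e.1; have := xyh e.2; rewrite /edge_form !ltr_norml.
by move=> /andP[? ?] /andP[? ?] ?; lra.
Qed.

Lemma interior_pointP (m : M) :
  interior_point m <-> (forall e, e \in hasseP -> 1 <= edge_form e (val m)).
Proof.
split=> [[_ [eps eps0 epsP]] e eE|mP]; last first.
  split; first exact: cone_pointP.
  have [|eps eps0 epsP] := @cone_strict_nbhs (real_point Rl (val m)).
    by move=> e /mP me; rewrite edge_formE ltr0z; exact: lt_le_trans me.
  by exists eps => // y _; exact: epsP.
set x := real_point Rl (val m) in epsP.
have fx0 : 0 <= edge_form e (val m) by have /coneP := cone_pointP m; apply.
rewrite -gtz0_ge1 lt_neqAle fx0 andbT; apply/eqP => fx.
pose w := real_point Rl rank_point.
have wC : cone w.
  by apply/coneP => e' /rank_pointP; exact: le_trans.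
pose B := \sum_i `|w i - x i| + 1.
have B0 : 0 < B by rewrite ltr_wpDl // sumr_ge0.
pose t := eps / B.
have t0 : 0 < t by rewrite divr_gt0.
pose y : {ffun option P -> Rl} := [ffun i => (1 + t) * x i - t * w i].
have yC : cone y.
  apply: epsP.
    exists [:: (1 + t, x); (- t, w)]; split.
    - by move=> p; rewrite !inE => /orP[] /eqP -> //=; exact: cone_pointP.
    - by rewrite big_cons big_seq1 /= addrK.
    - by move=> i; rewrite big_cons big_seq1 /= ffunE mulNr.
  move=> i; have -> : x i - y i = t * (w i - x i) by rewrite [y i]ffunE; ring.
  rewrite normrM gtr0_norm // /t mulrAC ltr_pdivrMr // ltr_pM2l //.
  rewrite /B (bigD1 i) //= -addrA ltrDl ltr_wpDl // sumr_ge0 //.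
have /forall_inP/(_ _ eE) := yC; apply/negP; rewrite -ltNge.
have -> : edge_form e y = (1 + t) * edge_form e x - t * edge_form e w.
  by rewrite /edge_form /y; case: (e) => [[|a|] [|b|]] /=; rewrite ?ffunE; ring.
rewrite {1}/x edge_formE -fx mulr0 sub0r oppr_lt0 mulr_gt0 //.
by rewrite edge_formE ltr0z; exact: lt_le_trans (rank_pointP eE).
Qed.

Lemma rank_cone : cone (real_point Rl rank_point).
Proof. by apply/coneP => e /rank_pointP; exact: le_trans. Qed.

Definition rank_cp : M := ConePoint rank_cone.

Lemma rank_interior : interior_point rank_cp.
Proof. by apply/interior_pointP; exact: rank_pointP. Qed.

(* Indicator of the principal down-set of a point x of hat P, x <> 1. *)
Definition down_ind (x : hat P) : {ffun option P -> int} :=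
  [ffun i => if i is Some a then ((Elt a <= x)%O : nat)%:Z else 1].

Lemma down_indE x z : x != Top -> hat_coord (down_ind x) z = ((z <= x)%O : nat)%:Z.
Proof.
move=> xT; case: z => [|a|] /=; rewrite ?ffunE //.
by case: x xT.
Qed.

Lemma down_ind_form x e : x != Top -> e \in hasseP ->
  0 <= edge_form e (down_ind x) <= 1.
Proof.
move=> xT; rewrite inE => /andP[e12 _]; rewrite /edge_form !down_indE //.
have := @le_trans _ _ e.2 e.1 x (ltW e12).
by case: (e.1 <= x)%O; case: (e.2 <= x)%O => // /(_ isT).
Qed.

Lemma down_ind_form1 e : e \in hasseP -> edge_form e (down_ind e.1) = 1.
Proof.
rewrite inE => /andP[e12 _].
have e1T : e.1 != Top.
  by apply: contraTneq e12 => ->; case: e.2.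
by rewrite /edge_form !down_indE // lexx lt_geF.
Qed.

Lemma down_cone x : x != Top -> cone (real_point Rl (down_ind x)).
Proof. by move=> xT; apply/coneP => e /(down_ind_form xT)/andP[]. Qed.

Lemma monomialM a b : monomial (mmul a b) = monomial a * monomial b.
Proof. by rewrite /monomial malgM_def fgmulUU mulr1. Qed.

Lemma monomial_neq0 m : monomial m != 0.
Proof. by rewrite /monomial monalgU_eq0 oner_eq0. Qed.

Lemma monomial_div (m u : M) : (forall e, e \in hasseP ->
    edge_form e (val u) <= edge_form e (val m)) ->
  exists k, m = mmul u k.
Proof.
move=> um; have kC : cone (real_point Rl (val m - val u)).
  by apply/coneP => e /um; rewrite edge_formD edge_formN subr_ge0.
by exists (ConePoint kC); apply: val_inj; rewrite /= addrC subrK.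
Qed.

Lemma canonical_gen m : interior_point m -> canonical_ideal (monomial m).
Proof.
move=> mi; exists [:: (1, monomial m)]; rewrite big_seq1 mul1r; split => //.
by move=> p; rewrite inE => /eqP -> /=; exists m.
Qed.

Lemma canonical_add f g :
  canonical_ideal f -> canonical_ideal g -> canonical_ideal (f + g).
Proof.
move=> [s [sP ->]] [t [tP ->]]; exists (s ++ t); rewrite big_cat; split=> // p.
by rewrite mem_cat => /orP[/sP|/tP].
Qed.

Lemma canonical_mul f g : canonical_ideal g -> canonical_ideal (f * g).
Proof.
move=> [s [sP ->]]; exists [seq (f * p.1, p.2) | p <- s]; split.
  by move=> _ /mapP[p /sP ps ->].
by rewrite big_map mulr_sumr; apply: eq_bigr => p _; rewrite mulrA.
Qed.

Lemma canonical_supp (g : R) :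
  (forall m, m \in msupp g -> interior_point m) -> canonical_ideal g.
Proof.
move=> gP; exists [seq (malgC g@_m : R, monomial m) | m <- msupp g]; split.
  by move=> _ /mapP[m /gP mi ->] /=; exists m.
rewrite big_map {1}[g]monalgE; apply: eq_bigr => m _ /=.
by rewrite /monomial malgM_def fgmulUU mulr1 mul1m.
Qed.

Lemma canonical_divisorial : is_divisorial canonical_set.
Proof.
have cz : canonical_ideal 0.
  by exists [::]; rewrite big_nil; split.
split.
  split.
  - by exists 0; rewrite ?tofrac0.
  - move=> _ _ [f fi <-] [g gi <-].
    by exists (f + g); rewrite ?tofracD //; exact: canonical_add.
  - move=> a _ [f fi <-].
    by exists (a * f); rewrite ?tofracM //; exact: canonical_mul.
  - exists (tofrac (monomial rank_cp)); last by rewrite tofrac_eq0 monomial_neq0.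
    by exists (monomial rank_cp) => //; exact/canonical_gen/rank_interior.
  - exists 1; first exact: oner_neq0.
    by move=> _ [f _ <-]; rewrite tofrac1 mul1r; exact: intF.
apply/seteqP; split; last exact: sub_colon2.
move=> y yP.
have [g _ gy] : integral_elts y.
  rewrite -[y]mulr1; apply: yP => _ [f _ <-].
  by rewrite mul1r; exact: intF.
rewrite -{}gy in yP *; exists g => //; apply: canonical_supp => m mg.
apply/interior_pointP => e eE.
have e1T : e.1 != Top.
  by move: eE; rewrite inE => /andP[e12 _]; apply: contraTneq e12 => ->; case: e.2.
pose u : M := ConePoint (down_cone e1T).
have u0 : tofrac (monomial u) != 0 by rewrite tofrac_eq0 monomial_neq0.
have [h _ hg] : integral_elts (tofrac g * (tofrac (monomial u))^-1).
  apply: yP => _ [_ [s [sP ->]] <-].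
  suff [h ->] : exists h, \sum_(p <- s) p.1 * p.2 = monomial u * h.
    by rewrite tofracM mulKf //; exact: intF.
  elim: s sP => [|p s IHs] sP; first by exists 0; rewrite big_nil mulr0.
  have [|h hE] := IHs; first by move=> q qs; apply: sP; rewrite inE qs orbT.
  have [n ni np] := sP _ (mem_head p s).
  have [|k nk] := @monomial_div n u.
    move=> e' e'E; have /interior_pointP/(_ _ e'E) := ni; apply: le_trans.
    by have /andP[] := down_ind_form e1T e'E.
  exists (p.1 * monomial k + h).
  by rewrite big_cons hE -np nk monomialM mulrDr mulrCA.
have gE : g = monomial u * h.
  apply/eqP; rewrite -tofrac_eq tofracM hg mulrC divfK //.
move: mg; rewrite gE => /msuppM_le[a [b [au _ ->]]].
move: au; rewrite /monomial msuppU oner_eq0 in_fset1 => /eqP ->.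
rewrite [val _]/(val u + val b) edge_formD /= down_ind_form1 // lerDl.
by have /coneP := cone_pointP b; apply.
Qed.

Definition canonical_module : divisorial_ideal R :=
  DivisorialIdeal canonical_divisorial.

End CanonicalIdeal.

(* Main.v *)
Require Import Defs.
From mathcomp Require Import all_boot all_order all_algebra.
From mathcomp Require Import reals.
From mathcomp Require Import finmap monalg.
From mathcomp Require Import zify.

Local Open Scope ring_scope.

Set Implicit Arguments.
Unset Strict Implicit.
Unset Printing Implicit Defensive.

Import Order.TTheory GRing.Theory Num.Theory.

(** Both sides of the equivalence say that some integer vector v has
    [edge_form e v = 1] on every edge e of the Hasse diagram of [hat P].

    Algebra ([canonical_principalP]).  The class of the canonical module
    vanishes exactly when the canonical ideal is generated by one element g.
    Interior lattice points are those on which every edge form is at least 1.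
    If v exists, then m - v lies in the cone for every interior m, so the
    monomial with exponent v generates.  Conversely, let a be the largest
    exponent of g for a monomial order.  Every interior monomial m is g * h, and
    leading exponents add up in a product, so a is an interior point and m - a
    lies in the cone.  Hence each edge form is minimal at a among the interior
    points.  That minimum is 1: for each edge [edge_tight_point] builds an
    interior point on which the form of this edge equals 1.

    Combinatorics ([pure_unit_point]).  A vector v as above is a function on
    [hat P] which drops by 1 along each covering relation.  Given such a
    function, the length of a maximal chain is the difference of the values at
    the two ends ([graded_pure]).  If the poset is pure, the function sends x to
    the number of elements above x in any maximal chain through x; purity makes
    this independent of the chain, because the lower half of one maximal chain
    through x and the upper half of another one form a maximal chain
    ([card_upper_pure], [pure_graded]).  Finally, purity of P and of [hat P] are
    equivalent, since the maximal chains of [hat P] are those of P with the two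
    new elements added ([pure_hat]). *)

(** * Maximal chains of a finite poset *)

Section MaximalChains.
Variables (d : Order.disp_t) (Q : finPOrderType d).
Implicit Types (C D : {set Q}) (x y z : Q).

Lemma chainP C :
  reflect {in C &, forall x y, (x >=< y)%O} (is_chain C).
Proof.
apply: (iffP forall_inP) => [h x y xC yC|h x xC].
  exact: (forall_inP (h x xC)).
by apply/forall_inP => y; exact: h.
Qed.

Lemma maxchain_chain C : maxset (@is_chain d Q) C ->
  {in C &, forall x y, (x >=< y)%O}.
Proof. by case/maxsetP => /chainP. Qed.

(** Maximality of a chain in the form in which it is used: an element comparable
    with the whole chain already belongs to it. *)
Lemma maxchainP C :
  reflect ({in C &, forall x y, (x >=< y)%O} /\
           forall z, {in C, forall c, (z >=< c)%O} -> z \in C)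
          (maxset (@is_chain d Q) C).
Proof.
apply: (iffP maxsetP) => -[]; last first.
  move=> /chainP cC max; split=> // D /chainP cD CD; apply/eqP.
  rewrite eqEsubset CD andbT; apply/subsetP => z zD; apply: max => c /(subsetP CD).
  exact: cD.
move=> /chainP cC max; split=> // z zC.
rewrite -(max (z |: C)) ?setU11 ?subsetUr //; apply/chainP => x y.
rewrite !inE => /predU1P[->|xC] /predU1P[->|yC].
- exact: comparablexx.
- exact: zC.
- by rewrite comparable_sym zC.
- exact: cC.
Qed.

Lemma maxchain_extend x y : (x <= y)%O ->
  exists C, [/\ maxset (@is_chain d Q) C, x \in C & y \in C].
Proof.
move=> xy; have [|C maxC /subsetP sC] := @maxset_exists _ (@is_chain d Q) [set x; y].
  apply/chainP => a b; rewrite !inE.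
  by case/orP=> /eqP -> /orP[] /eqP ->; rewrite ?comparablexx // /Order.comparable xy ?orbT.
by exists C; split; rewrite // sC // !inE eqxx ?orbT.
Qed.

Definition upper C x : {set Q} := C :&: [set z | (x <= z)%O].

(** Nothing lies strictly between x and y, so passing from y down to x in the
    chain adds x alone. *)
Lemma card_upper_cover C x y : maxset (@is_chain d Q) C ->
  x \in C -> y \in C -> (x, y) \in hasse_edges Q ->
  #|upper C x| = #|upper C y|.+1.
Proof.
move=> /maxchain_chain cC xC yC; rewrite inE /= => /andP[xy /existsPn noz].
have -> : upper C x = x |: upper C y.
  apply/setP => z; rewrite !inE; have [->|zx] := eqVneq z x; first by rewrite xC lexx.
  case zC: (z \in C) => //=; apply/idP/idP => [xz|]; last exact/le_trans/ltW.
  move: (noz z) (cC _ _ yC zC); rewrite lt_neqAle eq_sym zx xz /=.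
  by move=> nzy /orP[//|]; rewrite le_eqVlt (negPf nzy) orbF => /eqP ->.
by rewrite cardsU1 !inE (lt_geF xy) andbF.
Qed.

(** The element following x in a maximal chain covers x in the whole poset:
    an element strictly in between would be comparable with the whole chain. *)
Lemma maxchain_next C x t : maxset (@is_chain d Q) C ->
  x \in C -> t \in C -> (x < t)%O ->
  exists2 y, y \in C & (x, y) \in hasse_edges Q.
Proof.
move=> /maxchainP[cC max] xC tC xt.
(* In a chain, minimising the size of the down-set picks the least element. *)
have Pt : (t \in C) && (x < t)%O by rewrite tC.
case: (@arg_minnP _ t (fun z => (z \in C) && (x < z)%O)
         (fun z => #|[pred s | s <= z]%O|) Pt) => y /andP[yC xy] ymin.
have yleast c : c \in C -> (x < c)%O -> (y <= c)%O.
  move=> cinC xc; have /orP[//|cy] := cC _ _ yC cinC.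
  have /ymin := introT andP (conj cinC xc); apply: contraTT => nyc.
  rewrite -ltnNge; apply: proper_card; apply/properP; split.
    by apply/subsetP => s; rewrite !inE => /le_trans; apply.
  by exists y; rewrite !inE ?lexx.
exists y => //; rewrite inE /= xy; apply/existsPn => z; apply/negP => /andP[xz zy].
have zC : z \in C.
  apply: max => c cinC; rewrite /Order.comparable.
  have /orP[] := cC _ _ xC cinC; last by move=> /le_trans/(_ (ltW xz)) ->; rewrite orbT.
  rewrite le_eqVlt => /predU1P[<-|/(yleast _ cinC)]; first by rewrite (ltW xz) orbT.
  by move=> /(le_trans (ltW zy)) ->.
by have := yleast _ zC xz; rewrite (lt_geF zy).
Qed.

(** An element comparable with the spliced chain is comparable with x, hence with
    everything on the other side of x in C, or in D, as well. *)
Lemma maxchain_splice C D x : maxset (@is_chain d Q) C ->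
  maxset (@is_chain d Q) D -> x \in C -> x \in D ->
  maxset (@is_chain d Q) (C :\: [set z | (x <= z)%O] :|: upper D x).
Proof.
move=> /maxchainP[cC maxC] /maxchainP[cD maxD] xC xD.
have below c : c \in C -> ~~ (x <= c)%O -> (c <= x)%O.
  by move=> cinC /negPf nxc; have := cC _ _ xC cinC; rewrite /Order.comparable nxc.
apply/maxchainP; split=> [a b|z zE].
  rewrite !inE => /orP[/andP[na aC]|/andP[aD xa]] /orP[/andP[nb bC]|/andP[bD xb]].
  - exact: cC.
  - by rewrite /Order.comparable (le_trans (below _ aC na) xb).
  - by rewrite /Order.comparable (le_trans (below _ bC nb) xa) orbT.
  - exact: cD.
rewrite !inE; have [xz|nxz] /= := boolP (x <= z)%O.
  rewrite andbT; apply: maxD => c cinD; have [xc|nxc] := boolP (x <= c)%O.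
    by apply: zE; rewrite !inE cinD xc orbT.
  have := cD _ _ xD cinD; rewrite /Order.comparable (negPf nxc) /= => cx.
  by rewrite (le_trans cx xz) orbT.
rewrite andbF orbF; apply: maxC => c cinC; have [xc|nxc] := boolP (x <= c)%O.
  have := zE x; rewrite !inE lexx xD orbT /Order.comparable (negPf nxz) orbF.
  by move=> /(_ isT) zx; rewrite (le_trans zx xc).
by apply: zE; rewrite !inE cinC nxc.
Qed.

(** Splicing changes the part of C above x and nothing else, while purity keeps
    the total cardinality. *)
Lemma card_upper_pure C D x : pure Q -> maxset (@is_chain d Q) C ->
  maxset (@is_chain d Q) D -> x \in C -> x \in D -> #|upper C x| = #|upper D x|.
Proof.
move=> pQ maxC maxD xC xD.
have := pQ _ _ maxC (maxchain_splice maxC maxD xC xD).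
set U := [set z | (x <= z)%O].
rewrite -(cardsID U C) -(cardsID U (_ :|: _)) setIUl setDUl.
have -> : (C :\: U) :&: U = set0 by rewrite setIDAC setDIl setDv setI0.
have -> : upper D x :&: U = upper D x by rewrite /upper -setIA setIid.
have -> : (C :\: U) :\: U = C :\: U by rewrite setDDl setUid.
have -> : upper D x :\: U = set0 by rewrite /upper setDIl setDv setI0.
by rewrite set0U setU0 => /addIn.
Qed.

(** The height of x is its number of upper elements in a maximal chain through
    x; to compare the heights of x and y, both are computed in one chain that
    contains x and y. *)
Lemma pure_graded : pure Q ->
  exists h : Q -> nat, forall x y, (x, y) \in hasse_edges Q -> h x = (h y).+1.
Proof.
move=> pQ.
have chainx x : exists C, maxset (@is_chain d Q) C && (x \in C).
  by have [C [maxC xC _]] := maxchain_extend (lexx x); exists C; rewrite maxC.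
pose Cx x := xchoose (chainx x).
exists (fun x => #|upper (Cx x) x|) => x y xy.
have le_xy : (x <= y)%O by move: xy; rewrite inE => /andP[/ltW].
have [C [maxC xC yC]] := maxchain_extend le_xy.
have /andP[maxx xx] : maxset (@is_chain d Q) (Cx x) && (x \in Cx x) by exact: (xchooseP (chainx x)).
have /andP[maxy yy] : maxset (@is_chain d Q) (Cx y) && (y \in Cx y) by exact: (xchooseP (chainx y)).
rewrite (card_upper_pure pQ maxx maxC) // (card_upper_pure pQ maxy maxC) //.
exact: card_upper_cover.
Qed.

(** A maximal chain climbs from b to t by covering steps, and h drops by 1 at
    each of them. *)
Lemma graded_pure b t (h : Q -> int) : (forall x, b <= x <= t)%O ->
  (forall x y, (x, y) \in hasse_edges Q -> h x = h y + 1) -> pure Q.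
Proof.
move=> bt hE.
suff H C : maxset (@is_chain d Q) C -> #|C|%:Z = h b - h t + 1.
  by move=> C D /H hC /H hD; apply/eqP; rewrite -eqz_nat hC hD.
move=> maxC; have [cC max] := maxchainP _ maxC.
have le_t z : (z <= t)%O by case/andP: (bt z).
have tC : t \in C.
  by apply: max => c _; rewrite /Order.comparable le_t orbT.
have bC : b \in C.
  by apply: max => c _; rewrite /Order.comparable; case/andP: (bt c) => ->.
have -> : C = upper C b.
  by apply/setP => c; rewrite !inE; case/andP: (bt c) => ->; rewrite andbT.
(* Induction along the chain, from its top downwards. *)
move: bC; move: b {bt} => x xC.
have [n] := ubnP #|upper C x|; elim: n x xC => // n IHn x xC.
have [->|xt] := eqVneq x t.
  move=> _; suff -> : upper C t = [set t] by rewrite cards1 subrr.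
  apply/setP => z; rewrite !inE; have [->|zt] := eqVneq z t; first by rewrite tC lexx.
  by rewrite lt_geF ?andbF // lt_neqAle zt le_t.
have {}xt : (x < t)%O by rewrite lt_neqAle xt le_t.
have [y yC xy] := maxchain_next maxC xC tC xt.
rewrite (card_upper_cover maxC xC yC xy) ltnS => /(IHn _ yC) IHy.
by rewrite -addn1 PoszD IHy (hE _ _ xy); lia.
Qed.

End MaximalChains.

(** * Adjoining a least and a greatest element *)

Section HatChains.
Variables (d : Order.disp_t) (P : finPOrderType d).

Definition hat_set (A : {set P}) : {set hat P} :=
  [set x | if x is Elt a then a \in A else true].

Lemma card_hat_set A : #|hat_set A| = #|A|.+2.
Proof.
have -> : hat_set A = Bot |: (Top |: (@Elt P @: A)).
  apply/setP => -[|a|]; rewrite !inE //=.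
  by apply/idP/imsetP => [aA|[b bA [->]]] //; exists a.
rewrite !cardsU1 card_imset => [|a b [->]] //.
have nB : Bot \notin @Elt P @: A by apply/imsetP => -[].
have nT : Top \notin @Elt P @: A by apply/imsetP => -[].
by rewrite !inE (negPf nB) (negPf nT).
Qed.

Lemma maxchain_hat A :
  maxset (@is_chain d P) A -> maxset (@is_chain d (hat P)) (hat_set A).
Proof.
move=> /maxchainP[cA maxA]; apply/maxchainP; split.
  by move=> [|a|] [|b|]; rewrite ?inE //; exact: cA.
move=> [|a|] aE; rewrite inE //; apply: maxA => b bA.
by apply: (aE (Elt b)); rewrite inE.
Qed.

Lemma maxchain_hat_inv C : maxset (@is_chain d (hat P)) C ->
  exists2 A, maxset (@is_chain d P) A & C = hat_set A.
Proof.
move=> /maxchainP[cC maxC].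
have BC : Bot \in C by apply: maxC => c _.
have TC : Top \in C by apply: maxC => -[].
exists [set a | Elt a \in C]; last by apply/setP => -[|a|]; rewrite !inE.
apply/maxchainP; split=> [a b|a aE]; rewrite !inE; first exact: cC.
by apply: maxC => -[|b|] // bC; apply: aE; rewrite inE.
Qed.

Lemma pure_hat : pure (hat P) <-> pure P.
Proof.
split=> [pH A B /maxchain_hat hA /maxchain_hat hB|pP C D].
  by have := pH _ _ hA hB; rewrite !card_hat_set => -[].
move=> /maxchain_hat_inv[A maxA ->] /maxchain_hat_inv[B maxB ->].
by rewrite !card_hat_set (pP A B).
Qed.

(** The coordinate at the top is fixed to be 0, so an arbitrary function on
    [hat P] becomes a vector only after its value at the top is subtracted; edge
    forms do not see this shift. *)
Definition potential_point (h : hat P -> int) : {ffun option P -> int} :=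
  [ffun i => h (if i is Some a then Elt a else Bot) - h Top].

Lemma edge_form_potential h e :
  edge_form e (potential_point h) = h e.1 - h e.2.
Proof.
by case: e => [[|a|] [|b|]]; rewrite /edge_form /= ?ffunE ?subrr ?subr0 ?sub0r ?opprB ?subrKA.
Qed.

Lemma pure_unit_point : pure P <->
  exists v : {ffun option P -> int},
    forall e, e \in hasse_edges (hat P) -> edge_form e v = 1.
Proof.
rewrite -pure_hat; split=> [/pure_graded[h hE]|[v vE]].
  exists (potential_point (fun x => (h x)%:Z)) => -[x y] /hE hxy.
  by rewrite edge_form_potential /= hxy; lia.
apply: (@graded_pure _ _ Bot Top (hat_coord v)); first by case.
by move=> x y /vE; rewrite /edge_form /=; lia.
Qed.

(** For an edge (x, y), start from the rank point and lift y, together with all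
    that lies below y except x, until y sits just below x.  An edge (z, t) could
    only lose height if t is lifted and z is not.  Then z = x and x < t <= y, so
    (z, t) is the edge (x, y) itself. *)
Lemma edge_tight_point e : e \in hasse_edges (hat P) ->
  exists2 v : {ffun option P -> int}, edge_form e v = 1 &
    forall e', e' \in hasse_edges (hat P) -> 1 <= edge_form e' v.
Proof.
case: e => x y xyE; pose r := hat_coord (rank_point P).
have rxy : 1 <= r x - r y by exact: (rank_pointP xyE).
move: (xyE); rewrite inE /= => /andP[xy /existsPn noz].
pose h z := r z + if (z <= y)%O && (z != x) then r x - r y - 1 else 0.
exists (potential_point h).
  by rewrite edge_form_potential /h /= lexx (gt_eqF xy) eqxx andbF /=; lia.
move=> [z t] ztE; rewrite edge_form_potential /h /=.
have rzt : 1 <= r z - r t by exact: (rank_pointP ztE).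
move: ztE; rewrite inE /= => /andP[zt _].
have [ty|nty] := boolP (t <= y)%O; last first.
  by case: ifP => _ /=; lia.
rewrite (le_trans (ltW zt) ty) /=.
have [tx|tx] := eqVneq t x; first by case: ifP => _ /=; lia.
have [zx|zx] /= := eqVneq z x; last by lia.
have ty' : t = y.
  by apply/eqP; have := noz t; rewrite -zx zt /= lt_neqAle ty andbT negbK.
by rewrite zx ty'; lia.
Qed.

End HatChains.

(** * Principality of the canonical ideal *)

Section Principal.
Variables (Rl : realType) (K : fieldType).
Variables (d : Order.disp_t) (P : finPOrderType d).
Local Notation M := (cone_point Rl P).
Local Notation R := (join_meet_ring Rl K P).
Local Notation hasseP := (hasse_edges (hat P)).

(** The exponents of a combination of interior monomials are sums of an interior
    point and a point of the cone. *)
Lemma canonical_ideal_supp (g : R) (m : M) :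
  canonical_ideal g -> m \in msupp g -> interior_point m.
Proof.
move=> [s [sP ->]]; elim: s sP => [|p s IHs] sP.
  by rewrite big_nil msupp0 in_fset0.
rewrite big_cons => /(fsubsetP (msuppD_le _ _)); rewrite in_fsetU => /orP[|]; last first.
  by apply: IHs => q qs; apply: sP; rewrite inE qs orbT.
have [n ni <-] := sP _ (mem_head p s) => /msuppM_le[a [b [_ bn ->]]].
move: bn; rewrite /monomial msuppU oner_eq0 in_fset1 => /eqP ->.
apply/interior_pointP => e eE.
rewrite [val _]/(val a + val n) edge_formD.
have /interior_pointP/(_ _ eE) n1 := ni.
have /coneP/(_ _ eE) a0 := cone_pointP a.
by rewrite -[1]add0r lerD.
Qed.

(** Leading exponents for the lexicographic order add up in products; the one of
    f, a, therefore works for all cofactors g at once. *)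
Lemma lead_exponent (f : R) : f != 0 -> exists2 a, a \in msupp f &
  forall g : R, g != 0 -> exists b, mmul a b \in msupp (f * g).
Proof.
move=> /msupp_max[a af aP]; exists a => // g /msupp_max[b bg bP].
have aP' x : x \in msupp f -> x = a \/ cp_gt a x.
  by move=> xf; have [|/(aP _ xf)] := eqVneq x a; [left | right].
have bP' x : x \in msupp g -> x = b \/ cp_gt b x.
  by move=> xg; have [|/(bP _ xg)] := eqVneq x b; [left | right].
exists b; rewrite -mcoeff_neq0 mcoeffMl.
rewrite (big_fsetD1 a) //= (big_fsetD1 b) //= eqxx mulr1n.
rewrite !big1_fset ?addr0.
- by rewrite mulf_neq0 // mcoeff_neq0.
- move=> x; rewrite in_fsetD1 => /andP[/eqP xa xf] _.
  rewrite big1_fset // => y yg _; case: eqP => // e.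
  by case: (cp_max_uniq (aP' _ xf) (bP' _ yg) e).
- move=> y; rewrite in_fsetD1 => /andP[/eqP yb yg] _; case: eqP => // e.
  by case: (cp_max_uniq (or_introl erefl) (bP' _ yg) e).
Qed.

(** A generator of the fractional ideal lies in it, hence is an element of R. *)
Lemma idclass_canonical_eq0 :
  idclass (canonical_module Rl K P) = 0 :> clgroup R <->
  exists2 g : R, g != 0 & forall f : R, canonical_ideal f <-> exists h, f = g * h.
Proof.
rewrite idclass_eq0; split=> [[x x0 xE]|[g g0 gE]].
  have [g gC gx] : divisorial_set (canonical_module Rl K P) x.
    by rewrite xE; exists 1; [exact: int1 | rewrite mulr1].
  rewrite -{}gx in x0 xE; exists g; first by rewrite -tofrac_eq0.
  move=> f; split=> [fC|[h ->]]; last by rewrite mulrC; exact: canonical_mul.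
  have : divisorial_set (canonical_module Rl K P) (tofrac f) by exists f.
  rewrite xE => -[_ [h _ <-]]; rewrite -tofracM => /eqP.
  by rewrite tofrac_eq => /eqP <-; exists h.
exists (tofrac g); first by rewrite tofrac_eq0.
apply/classical_sets.seteqP; split=> [_ [f /gE[h ->] <-]|_ [_ [h _ <-] <-]].
  by exists (tofrac h); [exact: intF | rewrite tofracM].
by exists (g * h); [apply/gE; exists h | rewrite tofracM].
Qed.

Lemma canonical_principalP :
  idclass (canonical_module Rl K P) = 0 :> clgroup R <->
  exists v : {ffun option P -> int},
    forall e, e \in hasseP -> edge_form e v = 1.
Proof.
rewrite idclass_canonical_eq0; split=> [[g g0 gE]|[v vE]].
  have [a ag aP] := lead_exponent g0.
  exists (val a) => e eE; apply/eqP; rewrite eq_le; apply/andP; split; last first.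
    have gC : canonical_ideal g by apply/gE; exists 1; rewrite mulr1.
    by have /interior_pointP := canonical_ideal_supp gC ag; apply.
  (* The value at a is at most the value at the interior point w = a + b. *)
  have [w we wP] := edge_tight_point eE.
  have wC : cone (real_point Rl w).
    by apply/coneP => e' /wP; exact: le_trans.
  pose m : M := ConePoint wC.
  have mi : interior_point m by apply/interior_pointP.
  have [h mE] := (gE _).1 (canonical_gen K mi).
  have h0 : h != 0.
    by apply: contra_eq_neq mE => ->; rewrite mulr0 monomial_neq0.
  have [b] := aP _ h0; rewrite -mE /monomial msuppU oner_eq0 in_fset1 => /eqP abm.
  rewrite -we (_ : w = val a + val b); last by rewrite -[w]/(val m) -abm.
  by rewrite edge_formD lerDl; have /coneP := cone_pointP b; apply.
have vC : cone (real_point Rl v) by apply/coneP => e /vE ->.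
pose a : M := ConePoint vC.
exists (monomial K a) => [|f]; first exact: monomial_neq0.
split=> [[s [sP ->]]|[h ->]]; last first.
  rewrite mulrC; apply/canonical_mul/canonical_gen/interior_pointP => e /vE.
  by move=> /= ->.
(* Each interior monomial is divisible by the one with exponent v, as all edge
   forms are at least 1 on it. *)
elim: s sP => [|p s IHs] sP; first by exists 0; rewrite big_nil mulr0.
have [|h hE] := IHs; first by move=> q qs; apply: sP; rewrite inE qs orbT.
have [n ni np] := sP _ (mem_head p s).
have [|k nk] := @monomial_div _ _ _ n a.
  by move=> e eE /=; rewrite vE //; have /interior_pointP := ni; apply.
exists (p.1 * monomial K k + h).
by rewrite big_cons hE -np nk monomialM mulrDr mulrCA.
Qed.

End Principal.

Theorem theorem2p2 (Rl : realType) (d : Order.disp_t) (P : finPOrderType d)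
    (K : fieldType) (P_nonempty : (0 < #|P|)%N) :
  idclass (canonical_module Rl K P) = 0 :> clgroup (join_meet_ring Rl K P)
  <-> pure P.
Proof.
by rewrite canonical_principalP pure_unit_point.
Qed.
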